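(* Let $L$ be a finite-dimensional Lie algebra over a field of characteristic $0$ and let $J$ be a Lie-orthogonal operator on $L$. Then $J(Z)\subseteq Z$, where $Z$ is the center of $L$.
   Context: A linear operator $J$ on a Lie algebra $L$ is called Lie-orthogonal if $[Jx,Jy]=[x,y]$ for all $x,y\in L$. *)

(* Defs.v *)
From HB Require Import structures.
From mathcomp Require Import all_boot all_order all_algebra.
From mathcomp Require Import classical_sets.

Set Implicit Arguments.
Unset Strict Implicit.
Unset Printing Implicit Defensive.

Import GRing.Theory.
Local Open Scope classical_set_scope.
Local Open Scope ring_scope.

HB.mixin Record Lmodule_isLieAlgebra (F : fieldType) (L : Type)
    of GRing.Lmodule F L := {
  lie_bracket : L -> L -> L;
  lie_bracket_linearl : forall y, linear (fun x => lie_bracket x y);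
  lie_bracket_linearr : forall x, linear (lie_bracket x);
  lie_bracketxx : forall x, lie_bracket x x = 0;
  lie_jacobi : forall x y z,
    lie_bracket x (lie_bracket y z) + lie_bracket y (lie_bracket z x)
      + lie_bracket z (lie_bracket x y) = 0
}.

#[short(type="lieAlgType")]
HB.structure Definition LieAlgebra (F : fieldType) :=
  { L of Lmodule_isLieAlgebra F L & GRing.Lmodule F L }.

(* Finite dimensionality is provided by the Vector structure. *)
#[short(type="finDimLieAlgType")]
HB.structure Definition FinDimLieAlgebra (F : fieldType) :=
  { L of LieAlgebra F L & Vector F L }.

Definition lie_center (F : fieldType) (L : lieAlgType F) : set L :=
  [set z | forall x, lie_bracket z x = 0].

Definition lie_orthogonal (F : fieldType) (L : lieAlgType F)
    (J : {linear L -> L}) : Prop :=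
  forall x y, lie_bracket (J x) (J y) = lie_bracket x y.

Arguments lie_center {F} L.

(* Main.v *)
(** Every vector [x] killed by a power [J^k] is central, since
    [[x, y] = [J^k x, J^k y] = 0].  The descending chain of images of the powers
    of [J] stabilises, say [J^k L = J^(k+1) L], so any [x] differs from some
    [J w] by a vector killed by [J^k]; hence [L = Z + J L].  For [z] central,
    [J z] commutes with [J L] because [[J z, J w] = [z, w] = 0]. *)
Require Import Defs.
From mathcomp Require Import all_boot all_order all_algebra.
From mathcomp Require Import classical_sets.
Import GRing.Theory.
Local Open Scope classical_set_scope.
Local Open Scope ring_scope.

Lemma lie_bracketDr (F : fieldType) (L : lieAlgType F) (x y z : L) :
  lie_bracket x (y + z) = lie_bracket x y + lie_bracket x z.
Proof. by have := lie_bracket_linearr x 1 y z; rewrite !scale1r. Qed.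

Lemma lie_bracketDl (F : fieldType) (L : lieAlgType F) (x y z : L) :
  lie_bracket (x + y) z = lie_bracket x z + lie_bracket y z.
Proof. by have := lie_bracket_linearl z 1 x y; rewrite !scale1r. Qed.

Lemma lie_bracket0l (F : fieldType) (L : lieAlgType F) (x : L) :
  lie_bracket 0 x = 0.
Proof. by apply: (addrI (lie_bracket 0 x)); rewrite -lie_bracketDl !addr0. Qed.

Lemma lie_bracket_antisym (F : fieldType) (L : lieAlgType F) (x y : L) :
  lie_bracket x y = - lie_bracket y x.
Proof.
apply/eqP; rewrite -addr_eq0.
have := lie_bracketxx (x + y).
by rewrite lie_bracketDl !lie_bracketDr !lie_bracketxx add0r addr0 => ->.
Qed.

Lemma iter_linearB (F : fieldType) (V : lmodType F) (f : {linear V -> V})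
    (k : nat) (x y : V) :
  iter k f (x - y) = iter k f x - iter k f y.
Proof. by elim: k => //= k ->; rewrite linearB. Qed.

Lemma mem_iter_limg (F : fieldType) (V : vectType F) (f : 'End(V)) (k : nat)
    (v : V) :
  v \in iter k (lfun_img f) fullv <-> exists x, v = iter k f x.
Proof.
elim: k v => [|k IHk] v /=; first by rewrite memvf; split=> // _; exists v.
split=> [/memv_imgP [u /IHk [x ->] ->]|[x ->]]; first by exists x.
by apply: memv_img; apply/IHk; exists x.
Qed.

(** The iterated images descend, and each strict inclusion costs at least one dimension, so strict
    inclusions cannot go on forever. *)
Lemma iter_limg_stable (F : fieldType) (V : vectType F) (f : 'End(V)) :
  exists k, (iter k (lfun_img f) fullv <= iter k.+1 (lfun_img f) fullv)%VS.
Proof.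
have sub k : (iter k.+1 (lfun_img f) fullv <= iter k (lfun_img f) fullv)%VS.
  by elim: k => [|k IHk]; [exact: subvf | exact: limgS].
(* Unless the chain has stabilised somewhere, its first [n] steps have lost at least [n]
   dimensions. *)
have drop n : (exists k, (iter k (lfun_img f) fullv
                          <= iter k.+1 (lfun_img f) fullv)%VS) \/
              (\dim (iter n (lfun_img f) fullv) + n <= \dim {:V})%N.
  elim: n => [|n [|IHn]]; [by right; rewrite addn0 | by left |].
  have := dimv_leqif_sup (sub n).
  case: (boolP (iter n _ _ <= _)%VS) => [le_n _|_ dim_lt]; first by left; exists n.
  right; apply: leq_trans IHn; rewrite addnS ltn_add2r.
  by rewrite (ltn_leqif dim_lt).
(* One step more than the dimension of [V] allows rules out the second alternative. *)
by case: (drop (\dim {:V}).+1) => //; rewrite addnS ltnNge leq_addl.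
Qed.

(** Where the chain of images is stable, [f^k x] equals [f^(k+1) w = f^k (f w)] for some [w], and
    this [w] serves. *)
Lemma iter_image_decomp (F : fieldType) (V : vectType F) (f : {linear V -> V}) :
  exists k, forall x, exists w, iter k f (x - f w) = 0.
Proof.
have [k /subvP le_k] := iter_limg_stable _ _ (linfun f); exists k => x.
have iterE n u : iter n (linfun f) u = iter n f u.
  by apply: eq_iter => v; rewrite lfunE.
have /le_k /mem_iter_limg [w] : 
    iter k (linfun f) x \in iter k (lfun_img (linfun f)) fullv.
  by apply/mem_iter_limg; exists x.
rewrite !iterE iterSr => eq_w; exists w.
by rewrite iter_linearB eq_w subrr.
Qed.

Lemma lie_orthogonal_nilp_central (F : fieldType) (L : lieAlgType F)
    (J : {linear L -> L}) (k : nat) (x : L) :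
  lie_orthogonal J -> iter k J x = 0 -> lie_center L x.
Proof.
move=> HJ Jx0 y.
suff <- : lie_bracket (iter k J x) (iter k J y) = lie_bracket x y.
  by rewrite Jx0 lie_bracket0l.
(* Each application of [J] to both arguments preserves the bracket. *)
by elim: k {Jx0} => //= k <-; rewrite HJ.
Qed.

Theorem lemma2 (F : fieldType) (char0 : [pchar F] =i pred0)
    (L : finDimLieAlgType F) (J : {linear L -> L}) (HJ : lie_orthogonal J) :
  J @` lie_center L `<=` lie_center L.
Proof.
move=> _ [z Zz <-] x.
have [k /(_ x)
  [w /(lie_orthogonal_nilp_central _ _ _ _ _ HJ) Zxw]] := iter_image_decomp _ _ J.
(* Split [x] as [(x - J w) + J w]; the second summand contributes [[J z, J w] = [z, w] = 0]. *)
rewrite -[x](subrK (J w)) lie_bracketDr HJ Zz addr0.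
(* The center is defined by brackets on the left, so antisymmetry brings the central [x - J w] to
   the front. *)
by rewrite lie_bracket_antisym Zxw oppr0.
Qed.
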